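(* Let $(n_i)_{i\geq 1}$ be a sequence of integers with $n_i>1$ for all $i$, let $\mathcal{C}_n=\bigoplus_{i\leq n}\mathbb{Z}_{n_i}$, and let $\mathcal{C}=\varprojlim_n\mathcal{C}_n$ along the projections onto initial factors, with the total order induced by the lexicographic orders on the $\mathcal{C}_n$. The mapping $\widehat{\phi}\colon K\mathcal{C}\to[0,1]$ defined by $$\widehat{\phi}(x)=\sum_{i\leq n}\frac{x_i}{n_1\cdot n_2\cdots n_i}\qquad\text{for } x\in\mathcal{C}_n\subseteq K\mathcal{C}$$ is strictly monotone (hence injective), and it has a Lawson-continuous, monotone and surjective extension $\widehat{\phi}\colon\mathcal{C}\to[0,1]$ defined by $\widehat{\phi}(x)=\sup\widehat{\phi}(\downarrow x\cap K\mathcal{C})$. Moreover, for each $x\in K\mathcal{C}$, $\widehat{\phi}(x')=\widehat{\phi}(x)$, where $x'=\sup(\downarrow x\setminus\{x\})\in K(\mathcal{C}^{op})$.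
   Context: $\mathbb{Z}_{k}=\{0<1<\cdots<k-1\}$ is the cyclic group of order $k$ with its order inherited from $\mathbb{N}$; $\mathcal{C}_n$ carries the lexicographic order. Elements of $\mathcal{C}$ are identified with sequences $(x_i)_{i\geq1}$, $x_i\in\mathbb{Z}_{n_i}$, and the induced order is: for $x\neq y$, $x<y$ iff $x_i<y_i$ at the first index $i$ where they differ. With this order $\mathcal{C}$ is a complete totally ordered lattice. Write $\downarrow x=\{y\mid y\leq x\}$ and $\uparrow x=\{y\mid x\leq y\}$. In a complete lattice $P$, an element $k$ is compact if for every directed $S\subseteq P$ with $k\leq\sup S$ there is $s\in S$ with $k\leq s$; $KP$ is the set of compact elements of $P$, and $P^{op}$ is $P$ with the opposite order. One regards $\mathcal{C}_n$ as a subset of $\mathcal{C}$ via the embedding $\iota_n(x)_j=x_j$ for $j\leq n$ and $\iota_n(x)_j=0$ for $j>n$; then $K\mathcal{C}=\bigcup_n\mathcal{C}_n$. A set $U\subseteq P$ is Scott open if it is an upper set and, for every directed $S\subseteq P$, $\sup S\in U$ implies $S\cap U\neq\emptyset$. The Lawson topology on $P$ has as a basis the sets $U\setminus\bigcup_{x\in F}\uparrow x$ with $U$ Scott open and $F\subseteq P$ finite; on $[0,1]$ it is the usual topology, and Lawson-continuous means continuous for the Lawson topologies.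
   Formalization: The membership x' ∈ K(C^op) is claimed only for x ≠ 0: for x = 0 one has x' = sup ∅ = 0, which is not compact in C^op, since the positive elements form a filtered set with infimum 0. All other claims, including φ̂(x') = φ̂(x), also cover x = 0. *)

(* Defs.v *)
From HB Require Import structures.
From mathcomp Require Import all_boot all_order all_algebra.
From mathcomp Require Import all_classical all_reals all_analysis.

Set Implicit Arguments.
Unset Strict Implicit.
Unset Printing Implicit Defensive.
Import Order.TTheory GRing.Theory Num.Theory.

Local Open Scope classical_set_scope.

Section DomainTheory.
Context {d : Order.disp_t} {P : porderType d}.

Definition down_set (x : P) : set P := [set y | (y <= x)%O].
Definition up_set (x : P) : set P := [set y | (x <= y)%O].

(* Directed sets are nonempty, as usual in domain theory; otherwise the least
   element would not be compact. *)
Definition directed (S : set P) : Prop :=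
  S !=set0 /\
  forall x y, S x -> S y -> exists z, [/\ S z, (x <= z)%O & (y <= z)%O].

(* Suprema are expressed by the relation [supremums S s] ("s is the supremum
   of S"), so that the definitions below make sense in any poset and are the
   usual ones in a complete lattice. *)
Definition compact_elements : set P :=
  [set k | forall (S : set P) (s : P), directed S -> supremums S s ->
     (k <= s)%O -> exists2 t, S t & (k <= t)%O].

Definition scott_open (U : set P) : Prop :=
  (forall x y, U x -> (x <= y)%O -> U y) /\
  (forall (S : set P) (s : P), directed S -> supremums S s -> U s ->
     S `&` U !=set0).

Definition lawson_basis : set (set P) :=
  [set W | exists U F, [/\ scott_open U, finite_set F
                         & W = U `\` \bigcup_(x in F) up_set x]].

Lemma lawson_basis_cover : \bigcup_(W in lawson_basis) W = setT.
Proof.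
apply/seteqP; split=> // x _; exists setT => //.
exists setT, set0; split; [split=> //| exact: finite_set0 |].
  by move=> S s [[y Sy] _] _ _; exists y.
by rewrite bigcup_set0 setD0.
Qed.

Lemma lawson_basis_join (V W : set P) (t : P) :
  lawson_basis V -> lawson_basis W -> V t -> W t ->
  exists X, [/\ lawson_basis X, X t & X `<=` V `&` W].
Proof.
move=> [U1 [F1 [[up1 so1] fin1 ->]]] [U2 [F2 [[up2 so2] fin2 ->]]] Vt Wt.
have DI : (U1 `&` U2) `\` \bigcup_(x in F1 `|` F2) up_set x =
    (U1 `\` \bigcup_(x in F1) up_set x) `&` (U2 `\` \bigcup_(x in F2) up_set x).
  by rewrite bigcup_setU !setDE setCU setIACA.
exists ((U1 `&` U2) `\` \bigcup_(x in F1 `|` F2) up_set x).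
rewrite DI; split=> //; rewrite -DI.
exists (U1 `&` U2), (F1 `|` F2); split=> //; last by rewrite finite_setU.
split=> [x y [U1x U2x] xy|S s dS sS [U1s U2s]].
  by split; [exact: up1 xy|exact: up2 xy].
have [x [Sx U1x]] := so1 S s dS sS U1s.
have [y [Sy U2y]] := so2 S s dS sS U2s.
have [z [Sz xz yz]] := dS.2 x y Sx Sy.
by exists z; split=> //; split; [exact: up1 xz|exact: up2 yz].
Qed.

End DomainTheory.

(* [lawson P] is [P] endowed with the Lawson topology. *)
Definition lawson {d : Order.disp_t} (P : porderType d) : Type := P.

HB.instance Definition _ {d : Order.disp_t} (P : porderType d) :=
  Choice.on (lawson P).

HB.instance Definition _ {d : Order.disp_t} (P : porderType d) :=
  @isBaseTopological.Build (lawson P) (set P : pointedType)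
    (@lawson_basis d P) id (@lawson_basis_cover d P) (@lawson_basis_join d P).

(* Sequences are indexed from 0: [b i] stands for $n_{i+1}$ and the digit
   [x i] for $x_{i+1}$. When [1 < b i], the type ['Z_(b i)] is the cyclic group
   of order [b i], and its order is that of the representatives in [nat]. *)
Definition digit (b : nat -> nat) : nat -> orderType _ := fun i => 'Z_(b i).

(* The inverse limit of the finite products of the [digit b i], identified
   with the set of digit sequences, under the lexicographic order. *)
Definition Cantor (b : nat -> nat) : orderType _ := big_lexi_order (digit b).


Definition Cfin (b : nat -> nat) (n : nat) := {dffun forall i : 'I_n, 'Z_(b i)}.

Definition iota_C {b : nat -> nat} {n : nat} (x : Cfin b n) : Cantor b :=
  fun i => match boolP (i < n)%N with
           | AltTrue lt_i_n => x (Ordinal lt_i_n)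
           | AltFalse _ => 0%R
           end.

Local Open Scope ring_scope.

Definition phi_fin {R : realType} {b : nat -> nat} {n : nat}
    (x : Cfin b n) : R :=
  \sum_(i < n) (x i : nat)%:R / (\prod_(j < i.+1) b j)%N%:R.

(* Main.v *)
Require Import Defs.
From HB Require Import structures.
From mathcomp Require Import all_boot all_order all_algebra.
From mathcomp Require Import all_classical all_reals all_analysis.

Set Implicit Arguments.
Unset Strict Implicit.
Unset Printing Implicit Defensive.
Import Order.TTheory GRing.Theory Num.Theory.

Local Open Scope classical_set_scope.
Local Open Scope ring_scope.

(** Write N_m(x) for the integer whose mixed-radix digits are the first m
    digits of x, and w_m = n_1 ... n_m. Then x <= y iff N_m(x) <= N_m(y) for
    all m, and Phi(x) = sup_m N_m(x) / w_m lies between N_m(x) / w_m and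
    (N_m(x) + 1) / w_m. For 0 < r <= 1 the integers ceil(r w_m) - 1 are the
    N_m of a sequence g(r), and g is lower adjoint to Phi:
    g(r) <= x iff r <= Phi(x), with Phi(g(r)) = r. Hence Phi is onto, and
    preimages of principal upper sets are principal upper sets; together with
    preservation of directed suprema this gives Lawson continuity. If x <> 0 is
    finite and m is large, then Phi(x) w_m = N_m(x), so that
    N_m(g(Phi(x))) = N_m(x) - 1: thus g(Phi(x)) is the immediate predecessor
    x' of x. In a chain, having an immediate predecessor makes x compact, and
    being one makes x' compact for the opposite order. *)

(** * Compactness in chains and Lawson continuity between posets *)

Lemma open_lawsonP d (P : porderType d) (A : set (lawson P)) :
  open A <-> exists2 D, D `<=` @lawson_basis d P & A = \bigcup_(W in D) W.
Proof.
split=> [[D sD <-]|[D sD ->]]; first by exists D.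
apply: bigcup_open => W DW; exists [set W]; last by rewrite bigcup_set1.
by move=> V ->; exact: sD.
Qed.

(** If no member of a directed set reaches [x], the whole set lies below [p], hence so does its
    supremum. When [x] is least, nonemptiness of the directed set is enough. *)
Lemma compact_elements_of_pred d (T : orderType d) (x p : T) :
  (forall z, (z < x)%O -> (z <= p)%O) ->
  ((p < x)%O \/ forall z, (x <= z)%O) -> compact_elements x.
Proof.
move=> xp px S s [[t0 St0] _] [_ leS] xs; apply: contrapT => nS.
have Sx t : S t -> (t < x)%O.
  by move=> St; rewrite ltNge; apply/negP => xt; apply: nS; exists t.
case: px => [px|x0]; last by have := Sx _ St0; rewrite ltNge x0.
have /(le_trans xs) : (s <= p)%O by apply: leS => t /Sx /xp.
by rewrite leNgt px.
Qed.

(** Everything strictly above [p] is at least [x], so in the opposite order [x] is the immediate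
    predecessor of [p]. *)
Lemma compact_elements_dual_pred d (T : orderType d) (x p : T) :
  (forall z, (z < x)%O -> (z <= p)%O) -> (p < x)%O ->
  @compact_elements _ T^d p.
Proof.
move=> xp px; apply: (@compact_elements_of_pred _ T^d p x); last by left.
move=> z; rewrite ltEdual => pz; rewrite leEdual leNgt; apply/negP => /xp.
by rewrite leNgt pz.
Qed.

Lemma supremums_below_pred d (T : orderType d) (x p : T) :
  (forall z, (z < x)%O -> (z <= p)%O) -> (p < x)%O ->
  supremums (down_set x `\ x) p.
Proof.
move=> xp px; split=> [z [zx /eqP zNx]|z]; last first.
  by apply; split; [exact: ltW|apply/eqP; rewrite lt_eqF].
by apply: xp; rewrite lt_neqAle zNx.
Qed.

(** The preimage of [up_set y] is [up_set (g y)], and preservation of directed suprema makes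
    preimages of Scott open sets Scott open; so basic sets pull back to basic sets. *)
Lemma continuous_lawson d d' (P : porderType d) (Q : porderType d')
    (f : P -> Q) (g : Q -> P) :
  (forall x y, (g y <= x)%O = (y <= f x)%O) ->
  (forall S s, directed S -> supremums S s -> supremums (f @` S) (f s)) ->
  continuous (f : lawson P -> lawson Q).
Proof.
move=> fg fsup; have fle : {homo f : x y / (x <= y)%O}.
  by move=> x y xy; rewrite -fg (le_trans _ xy)// fg.
apply/continuousP => _ /open_lawsonP[D sD ->].
rewrite preimage_bigcup; apply: bigcup_open => W /sD[U [F [[upU soU] finF ->]]].
apply/open_lawsonP; set V := _ @^-1` _.
exists [set V]; last by rewrite bigcup_set1.
move=> _ ->; exists (f @^-1` U), (g @` F); split.
- split=> [x y Ux xy|S s dS sS Us]; first exact: upU (fle _ _ xy).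
  have [|_ [[x Sx <-] Ux]] := soU _ _ _ (fsup S s dS sS) Us; last by exists x.
  split; first by have [[x Sx] _] := dS; exists (f x), x.
  move=> _ _ [x Sx <-] [y Sy <-]; have [z [Sz xz yz]] := dS.2 x y Sx Sy.
  by exists (f z); split; [exists z|exact: fle|exact: fle].
- exact: finite_image.
- apply/seteqP; split=> x [Ux nF]; split=> //.
    by move=> [_ [y Fy <-]]; rewrite /up_set /= fg => yx; apply: nF; exists y.
  move=> [y Fy yx]; apply: nF; exists (g y); first by exists y.
  by rewrite /up_set /= fg.
Qed.

(** * Mixed-radix numerators and the lexicographic order *)

Section Digits.
Context {R : realType} {b : nat -> nat} (b_gt1 : forall i, (1 < b i)%N).
Implicit Types (x y z : Cantor b) (m n : nat) (r : R).

(** In the notation of the overview, w_m is [weight m], N_m(x) is [numer x m], Phi is [value] and g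
    is [expansion]. *)
Definition weight m : nat := \prod_(j < m) b j.

Fixpoint numer x m : nat :=
  if m is m'.+1 then (numer x m' * b m' + (x m' : 'Z_(b m')))%N else 0%N.

Definition trunc x n : Cantor b :=
  fun i => if (i < n)%N then x i else 0 : 'Z_(b i).

Definition psum x m : R := (numer x m)%:R / (weight m)%:R.

Definition value x : R := sup (range (psum x)).

Definition zeroC : Cantor b := fun i => 0 : 'Z_(b i).

Let b_gt0 i : (0 < b i)%N. Proof. exact: ltnW. Qed.

Lemma digit_lt x i : ((x i : 'Z_(b i)) < b i)%N.
Proof. by rewrite -[ltnRHS](Zp_cast (b_gt1 i)) ltn_ord. Qed.

Lemma weightS m : weight m.+1 = (weight m * b m)%N.
Proof. by rewrite /weight big_ord_recr. Qed.

Lemma weight_gt0 m : (0 < weight m)%N.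
Proof. by rewrite prodn_gt0. Qed.

Lemma weightR_gt0 m : 0 < (weight m)%:R :> R.
Proof. by rewrite ltr0n weight_gt0. Qed.

Lemma weightR_neq0 m : (weight m)%:R != 0 :> R.
Proof. exact/lt0r_neq0/weightR_gt0. Qed.

(** With the Archimedean property, this makes 1 / w_m arbitrarily small. *)
Lemma ltn_weight m : (m < weight m)%N.
Proof.
elim: m => [|m IHm]; first exact: weight_gt0.
by rewrite weightS (leq_ltn_trans IHm)// ltn_Pmulr// weight_gt0.
Qed.

(** A digit is less than its base, so later digits cannot make up a deficit of one unit: N_n(x) b_n
    + x_n < (N_n(x) + 1) b_n <= N_n(y) b_n. *)
Lemma numer_lt_homo x y m n : (m <= n)%N ->
  (numer x m < numer y m)%N -> (numer x n < numer y n)%N.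
Proof.
elim: n => [|n IHn]; first by rewrite leqn0 => /eqP->.
rewrite leq_eqVlt => /predU1P[->//|]; rewrite ltnS => mn xy /=.
apply: (@leq_trans ((numer x n).+1 * b n)).
  by rewrite mulSn addnC ltn_add2r digit_lt.
apply: (@leq_trans (numer y n * b n)); rewrite ?leq_addr//.
by rewrite leq_mul2r IHn ?orbT.
Qed.

Lemma eq_numer x y m : same_prefix m x y -> numer x m = numer y m.
Proof.
elim: m => //= m IHm xy; rewrite IHm ?(xy m (ltnSn m))//.
exact: same_prefix_leq (leqnSn m) xy.
Qed.

(** Just after the first difference the numerators compare as the differing digits do, and a strict
    inequality persists. *)
Lemma lt_numer x y : (x < y)%O ->
  exists n, forall m, (n <= m)%N -> (numer x m < numer y m)%N.
Proof.
rewrite lt_neqAle leEbig_lexi_order => /andP[/eqP xNy].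
case E: (first_diff x y) => [n|]; last by move/first_diff_NoneP: E.
move/first_diff_SomeP: E => [pxy nxy] lxy; exists n.+1 => m nm.
apply: numer_lt_homo nm _ => /=; rewrite (eq_numer pxy) ltn_add2l.
by rewrite ltn_neqAle; apply/andP; split.
Qed.

(** A strict reverse inequality at [m] would persist to a stage where [x < y] already shows in the
    numerators. *)
Lemma le_numer x y m : (x <= y)%O -> (numer x m <= numer y m)%N.
Proof.
rewrite le_eqVlt => /predU1P[->//|/lt_numer[n xy]]; rewrite leqNgt; apply/negP.
move=> /(numer_lt_homo (leq_maxr n m)); apply/negP; rewrite -leqNgt ltnW//.
exact/xy/leq_maxl.
Qed.

Lemma numer_le x y n :
  (forall m, (n <= m)%N -> (numer x m <= numer y m)%N) -> (x <= y)%O.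
Proof.
move=> xy; rewrite leNgt; apply/negP => /lt_numer[p yx].
by have := yx _ (leq_maxr n p); rewrite ltnNge xy// leq_maxl.
Qed.

Lemma zeroC_le x : (zeroC <= x)%O.
Proof.
apply: (@numer_le _ _ 0) => m _; suff -> : numer zeroC m = 0%N by [].
by elim: m => //= m ->; rewrite mul0n.
Qed.

(** * Partial sums and the value of a sequence *)

Lemma psum_homo x : {homo psum x : m n / (m <= n)%N >-> m <= n}.
Proof.
apply: homo_leq => [//|? ? ?|m]; first exact: le_trans.
rewrite /psum ler_pdivrMr ?weightR_gt0// mulrAC.
rewrite ler_pdivlMr ?weightR_gt0// weightS.
rewrite -!natrM ler_nat /= mulnA mulnAC leq_mul2r; apply/orP; right.
by rewrite leq_addr.
Qed.

(** These are the upper ends of nested intervals: the new digit is at most b_m - 1, so N_{m+1}(x) +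
    1 <= (N_m(x) + 1) b_m. *)
Lemma psum_homoV x :
  {homo (fun m => psum x m + (weight m)%:R^-1) : m n / (m <= n)%N >-> n <= m}.
Proof.
move=> m n mn.
apply: (@homo_leq _ (fun m => psum x m + _) (fun p q => q <= p)) mn => //.
  by move=> p q r qp rq; exact: le_trans rq qp.
move=> {}m; rewrite /psum -[X in _ + X <= _]mul1r -[X in _ <= _ + X]mul1r.
rewrite -!mulrDl !natr1.
rewrite ler_pdivrMr ?weightR_gt0// mulrAC.
rewrite ler_pdivlMr ?weightR_gt0// weightS.
rewrite -!natrM ler_nat /= mulnA [leqRHS]mulnAC leq_mul2r; apply/orP; right.
by rewrite mulSn addnC ltn_add2r digit_lt.
Qed.

Lemma psum_ub x m n : psum x n <= psum x m + (weight m)%:R^-1.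
Proof.
apply: (le_trans (psum_homo x (leq_maxl n m))).
apply: le_trans (psum_homoV x (leq_maxr n m)).
by rewrite lerDl invr_ge0 ler0n.
Qed.

Lemma value_ub x : ubound (range (psum x)) (psum x 0 + (weight 0)%:R^-1).
Proof. by move=> _ [n _ <-]; exact: psum_ub. Qed.

Lemma psum_le_value x m : psum x m <= value x.
Proof. by apply: ub_le_sup; [exact: ex_intro _ _ (@value_ub x)|exists m]. Qed.

Lemma value_le x r : (forall m, psum x m <= r) -> value x <= r.
Proof.
by move=> xr; apply: ge_sup => [|_ [m _ <-]//]; exists (psum x 0), 0%N.
Qed.

Lemma value_le_psum x m : value x <= psum x m + (weight m)%:R^-1.
Proof. by apply: value_le => n; exact: psum_ub. Qed.

Lemma value_ge0 x : 0 <= value x.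
Proof. by apply: le_trans (psum_le_value x 0); rewrite /psum mul0r. Qed.

Lemma value_le1 x : value x <= 1.
Proof.
apply: le_trans (value_le_psum x 0) _.
by rewrite /psum mul0r add0r /weight big_ord0 invr1.
Qed.

Lemma value_homo x y : (x <= y)%O -> value x <= value y.
Proof.
move=> xy; apply: value_le => m; apply: le_trans (psum_le_value y m).
by rewrite ler_pM2r ?invr_gt0 ?weightR_gt0// ler_nat le_numer.
Qed.

(** * Truncations and finite sequences *)

Lemma same_prefix_trunc x n m : (m <= n)%N -> same_prefix m (trunc x n) x.
Proof. by move=> mn i im; rewrite /trunc (leq_trans im mn). Qed.

(** Each appended zero digit multiplies numerator and weight by the same base. *)
Lemma psum_trunc x n m : (n <= m)%N -> psum (trunc x n) m = psum x n.
Proof.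
elim: m => [|m IHm]; first by rewrite leqn0 => /eqP->.
rewrite leq_eqVlt => /predU1P[<-|].
  by rewrite /psum (eq_numer (same_prefix_trunc x (leqnn _))).
rewrite ltnS => nm; rewrite -(IHm nm) /psum /= {2}/trunc ltnNge nm /= addn0.
by rewrite weightS !natrM -mulf_div divff ?mulr1// pnatr_eq0 -lt0n.
Qed.

(** Past [n] the partial sums of the truncation stay at [psum x n] while those of [x] can only grow;
    over a common weight this orders the numerators. *)
Lemma trunc_le x n : (trunc x n <= x)%O.
Proof.
apply: (@numer_le _ _ n) => m nm; rewrite -(ler_nat R).
rewrite -(ler_pM2r (x := (weight m)%:R^-1)).
  by rewrite -!/(psum _ _) psum_trunc// psum_homo.
by rewrite invr_gt0 weightR_gt0.
Qed.

Lemma trunc_trunc x n m : (n <= m)%N -> trunc (trunc x m) n = trunc x n.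
Proof.
move=> nm; apply/functional_extensionality_dep => i; rewrite /trunc.
by case: ltnP => // /leq_trans->.
Qed.

Lemma trunc_homo x n m : (n <= m)%N -> (trunc x n <= trunc x m)%O.
Proof. by move=> nm; rewrite -(trunc_trunc x nm) trunc_le. Qed.

Lemma value_trunc x n : value (trunc x n) = psum x n.
Proof.
apply/eqP; rewrite eq_le -{2}(psum_trunc x (leqnn n)) psum_le_value andbT.
apply: value_le => m; rewrite -(psum_trunc x (leq_maxr m n)).
by apply: psum_homo; exact: leq_maxl.
Qed.

Lemma iota_C_ord n (x : Cfin b n) (i : 'I_n) : iota_C x i = x i.
Proof.
case: i => i ni; rewrite /iota_C.
case: {-}_ / (boolP (i < n)%N) => [ni'|/negP//] /=.
by rewrite (bool_irrelevance ni' ni).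
Qed.

Lemma iota_C_ge n (x : Cfin b n) i : (n <= i)%N -> iota_C x i = 0 :> 'Z_(b i).
Proof.
rewrite /iota_C; case: {-}_ / (boolP (i < n)%N) => // ?.
by rewrite leqNgt => /negP.
Qed.

(** This lets membership in C_n be handled as the equation [trunc x n = x]. *)
Lemma range_iota_C n : range (@iota_C b n) = [set x | trunc x n = x].
Proof.
apply/seteqP; split=> [_ [x _ <-]|x /= xn].
  apply/functional_extensionality_dep => i; rewrite /trunc.
  by case: ltnP => // ni; rewrite iota_C_ge.
exists [ffun i : 'I_n => x i] => //; apply/functional_extensionality_dep => i.
rewrite -[in RHS]xn /trunc; case: ltnP => [ni|/iota_C_ge->//].
by have := iota_C_ord [ffun i : 'I_n => x i] (Ordinal ni); rewrite ffunE.
Qed.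

Lemma psumE x n :
  psum x n = \sum_(i < n) (x i : 'Z_(b i))%:R / (weight i.+1)%:R.
Proof.
elim: n => [|n IHn]; first by rewrite big_ord0 /psum mul0r.
rewrite big_ord_recr -IHn /= /psum natrD mulrDl; congr (_ + _).
by rewrite weightS !natrM -mulf_div divff ?mulr1// pnatr_eq0 -lt0n.
Qed.

Lemma phi_finE n (x : Cfin b n) : phi_fin x = psum (iota_C x) n.
Proof.
rewrite psumE; apply: eq_bigr => i _; congr (_%:R / _).
by rewrite iota_C_ord.
Qed.

(** * The least sequence with a given value *)

(* The ceiling minus one, rather than the floor, yields the least sequence of
   value r; the truncated predecessor covers r = 0. *)
Definition quot r m : nat := `|Num.ceil (r * (weight m)%:R)|%N.-1.

(** The digits solve N_{m+1} = N_m b_m + x_m for N = [quot r]; for r in [0,1] the reduction by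
    [inZp] changes nothing. *)
Definition expansion r : Cantor b :=
  fun m => inZp (quot r m.+1 - quot r m * b m) : 'Z_(b m).

Lemma quot_itv r m : 0 < r ->
  (quot r m)%:R < r * (weight m)%:R <= (quot r m).+1%:R.
Proof.
move=> r0; have := ceil_itv (r * (weight m)%:R).
(* A positive ceiling is altered neither by the absolute value nor by the truncation of the
   predecessor. *)
have : 0 < Num.ceil (r * (weight m)%:R).
  by rewrite ceil_gt0 mulr_gt0 ?weightR_gt0.
rewrite /quot; case: (Num.ceil _) => // -[//|k] _ /=.
by rewrite [X in (X - 1)%:~R]intS addrAC subrr add0r.
Qed.

Lemma quot0 m : quot 0 m = 0%N.
Proof. by rewrite /quot mul0r ceil0. Qed.

Lemma numer_expansion r m : 0 <= r <= 1 -> numer (expansion r) m = quot r m.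
Proof.
rewrite le_eqVlt => /andP[/predU1P[<- _|r0 r1]].
  elim: m => [|m IHm] /=; rewrite ?quot0// IHm !quot0 mul0n.
  by rewrite mod0n.
elim: m => [|m IHm] /=.
  (* As w_0 = 1, the strict bound gives [quot r 0] < r <= 1, hence [quot r 0] = 0, the initial
     numerator. *)
  have /andP[+ _] := quot_itv 0 r0; rewrite /weight big_ord0 mulr1 => q0.
  by have := lt_le_trans q0 r1; rewrite ltrn1; case: quot.
have /andP[ql qu] := quot_itv m r0; have /andP[qSl qSu] := quot_itv m.+1 r0.
have bm0 : 0 < (b m)%:R :> R by rewrite ltr0n.
have qle : (quot r m * b m <= quot r m.+1)%N.
  rewrite -ltnS -(ltr_nat R) (lt_le_trans _ qSu)// weightS !natrM mulrA.
  by rewrite ltr_pM2r.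
have qlt : (quot r m.+1 < (quot r m).+1 * b m)%N.
  rewrite -(ltr_nat R) (lt_le_trans qSl)// weightS !natrM mulrA.
  by rewrite ler_pM2r.
rewrite IHm /expansion /= Zp_cast// modn_small ?subnKC//.
by rewrite ltn_subLR// addnC -mulSn.
Qed.

Lemma le_of_psum r x :
  (forall m, r <= psum x m + (weight m)%:R^-1) -> r <= value x.
Proof.
move=> rx; rewrite leNgt; apply/negP => xr.
have d0 : 0 < r - value x by rewrite subr_gt0.
(* Then w_m > m > 1 / (r - value x), so 1 / w_m is smaller than the gap. *)
pose m := Num.bound (r - value x)^-1.
have : r - value x <= (weight m)%:R^-1.
  by rewrite lerBlDl (le_trans (rx m))// lerD2r psum_le_value.
rewrite leNgt => /negP; apply; rewrite invf_plt ?posrE ?weightR_gt0//.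
apply: (lt_trans (archi_boundP _)); first by rewrite invr_ge0 ltW.
by rewrite ltr_nat ltn_weight.
Qed.

(** Left to right, r w_m <= [quot r m] + 1 <= N_m(x) + 1 for all m. Right to left, [quot r m] < r
    w_m <= N_m(x) + 1, and integrality gives [quot r m] <= N_m(x). The case r = 0 is separate. *)
Lemma expansion_le r x : 0 <= r <= 1 -> (expansion r <= x)%O = (r <= value x).
Proof.
move=> r01; have /andP[r0 r1] := r01; apply/idP/idP => [rx|].
  move: r0; rewrite le_eqVlt => /predU1P[<-|r0]; first exact: value_ge0.
  apply: le_of_psum => m; have /andP[_ rm] := quot_itv m r0.
  rewrite -[_^-1]mul1r -mulrDl natr1 ler_pdivlMr ?weightR_gt0//.
  by rewrite (le_trans rm)// ler_nat ltnS -numer_expansion// le_numer.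
move: r0; rewrite le_eqVlt => /predU1P[r0 _|r0 rx].
  apply: (@numer_le _ _ 0) => m _; rewrite numer_expansion//.
  by rewrite -r0 quot0.
apply: (@numer_le _ _ 0) => m _; rewrite numer_expansion//.
have /andP[rm _] := quot_itv m r0.
rewrite -ltnS -(ltr_nat R) (lt_le_trans rm)// -ler_pdivlMr ?weightR_gt0//.
rewrite (le_trans rx)// (le_trans (value_le_psum x m))//.
by rewrite -[X in _ + X]mul1r -mulrDl natr1.
Qed.

Lemma value_expansion r : 0 <= r <= 1 -> value (expansion r) = r.
Proof.
move=> r01; apply/eqP; rewrite eq_le -(expansion_le _ r01) lexx andbT.
apply: value_le => m; rewrite /psum numer_expansion//.
have /andP[+ _] := r01; rewrite le_eqVlt => /predU1P[<-|r0].
  by rewrite quot0 mul0r.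
by rewrite ler_pdivrMr ?weightR_gt0// ltW//; have /andP[] := quot_itv m r0.
Qed.

(** * Immediate predecessors and compact elements *)

Lemma value01 x : 0 <= value x <= 1.
Proof. by rewrite value_ge0 value_le1. Qed.

(** Beyond the support of [x], the product of its value and w_m is exactly the integer N_m(x), which
    is its own ceiling. *)
Lemma quot_value x n m : trunc x n = x -> (n <= m)%N ->
  quot (value x) m = (numer x m).-1.
Proof.
move=> xn nm; have -> : value x = psum x m.
  by rewrite -{1}xn value_trunc -{2}xn psum_trunc.
rewrite /quot /psum divfK ?weightR_neq0//.
by rewrite -[_%:R]/((numer x m)%:Z%:~R) intrKceil.
Qed.

Lemma lt_expansion_value x z n : trunc x n = x -> (z < x)%O ->
  (z <= expansion (value x))%O.
Proof.
move=> xn /lt_numer[p zx]; apply: (@numer_le _ _ (maxn n p)) => m.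
rewrite geq_max => /andP[nm pm]; rewrite numer_expansion ?value01//.
by rewrite (quot_value xn nm) -ltnS (leq_trans (zx m pm))// leqSpred.
Qed.

Lemma expansion_value_lt x n : trunc x n = x -> x <> zeroC ->
  (expansion (value x) < x)%O.
Proof.
move=> xn /eqP; rewrite eq_sym => x0.
have /lt_numer[p zx] : (zeroC < x)%O by rewrite lt_neqAle x0 zeroC_le.
rewrite ltNge; apply/negP => /(le_numer (maxn n p)).
rewrite numer_expansion ?value01// (quot_value xn (leq_maxl _ _)).
(* As [x] exceeds zero, N_m(x) is positive at this stage, so its predecessor is strictly smaller. *)
have := zx _ (leq_maxr n p); case: (numer x _) => // k _.
by rewrite ltnn.
Qed.

Lemma compact_trunc x n : trunc x n = x -> compact_elements x.
Proof.
move=> xn; apply: (@compact_elements_of_pred _ _ _ (expansion (value x))).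
  by move=> z; exact: lt_expansion_value xn.
have [->|/eqP x0] := eqVneq x zeroC; first by right; exact: zeroC_le.
by left; exact: expansion_value_lt xn x0.
Qed.

Lemma directed_truncs x : directed (range (trunc x)).
Proof.
split; first by exists (trunc x 0), 0%N.
move=> _ _ [m _ <-] [n _ <-]; exists (trunc x (maxn m n)).
by split; [exists (maxn m n)| |]; rewrite ?trunc_homo ?leq_maxl ?leq_maxr.
Qed.

Lemma supremums_truncs x : supremums (range (trunc x)) x.
Proof.
split=> [_ [n _ <-]|y ub_y]; first exact: trunc_le.
apply: (@numer_le _ _ 0) => m _.
rewrite -(eq_numer (same_prefix_trunc x (leqnn m))).
by apply: le_numer; apply: ub_y; exists m.
Qed.

(** Every sequence is the directed supremum of its truncations, so a compact one lies below one of
    them and equals it. *)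
Lemma compact_elementsE :
  @compact_elements _ (Cantor b) = \bigcup_n range (@iota_C b n).
Proof.
apply/seteqP; split=> [x cx|x [n _]]; last first.
  by rewrite range_iota_C => /compact_trunc.
have [_ [n _ <-] xn] :=
  cx _ _ (directed_truncs x) (supremums_truncs x) (lexx x).
by exists n => //; rewrite range_iota_C; apply/eqP; rewrite eq_le trunc_le.
Qed.

Lemma compact_elementsP x : compact_elements x <-> exists n, trunc x n = x.
Proof.
rewrite compact_elementsE; split=> [[n _]|[n xn]].
  by rewrite range_iota_C; exists n.
by exists n => //; rewrite range_iota_C.
Qed.

(** At a late enough stage m, Phi(x) = N_m(x) / w_m < N_m(y) / w_m <= Phi(y). *)
Lemma value_lt x y : compact_elements x -> (x < y)%O -> compact_elements y ->
  value x < value y.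
Proof.
move=> /compact_elementsP[n xn] xy /compact_elementsP[p yp].
have [q xyq] := lt_numer xy; pose m := maxn q (maxn n p).
have -> : value x = psum x m.
  by rewrite -{1}xn value_trunc -{2}xn psum_trunc// /m !leq_max leqnn !orbT.
apply: lt_le_trans (psum_le_value y m).
by rewrite ltr_pM2r ?invr_gt0 ?weightR_gt0// ltr_nat xyq// leq_maxl.
Qed.

(** * The map into the unit interval and its Lawson continuity *)

Definition value_i01 x : {i01 R} := Itv01 (value_ge0 x) (value_le1 x).

Lemma value_i01_homo : {homo value_i01 : x y / (x <= y)%O}.
Proof. by move=> x y xy; rewrite -num_le /= value_homo. Qed.

Lemma i01_itv (r : {i01 R}) : 0 <= r%:num <= 1.
Proof. by apply/andP; split. Qed.

Lemma value_i01_le x (u : {i01 R}) :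
  (forall n, (value_i01 (trunc x n) <= u)%O) -> (value_i01 x <= u)%O.
Proof.
move=> xu; rewrite -num_le /=; apply: value_le => n.
by rewrite -value_trunc; exact: xu.
Qed.

(** Each truncation of [s] is compact and below [s], hence below a member of [S]; the values of the
    truncations determine that of [s]. *)
Lemma value_i01_sup (S : set (Cantor b)) s : directed S -> supremums S s ->
  supremums (value_i01 @` S) (value_i01 s).
Proof.
move=> dS sS; split=> [_ [x Sx <-]|u ub_u].
  by apply: value_i01_homo; exact: sS.1.
apply: value_i01_le => n.
have cn : compact_elements (trunc s n).
  exact: compact_trunc (trunc_trunc s (leqnn n)).
have [t St nt] := cn S s dS sS (trunc_le s n).
by apply: le_trans (value_i01_homo nt) _; apply: ub_u; exists t.
Qed.

Lemma continuous_value_i01 :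
  continuous (value_i01 : lawson (Cantor b) -> lawson {i01 R}).
Proof.
apply: (@continuous_lawson _ _ _ _ _
  (fun r : {i01 R} => expansion r%:num)) value_i01_sup.
by move=> x r; rewrite expansion_le ?i01_itv.
Qed.

End Digits.

Theorem corollary2 (R : realType) (b : nat -> nat)
    (b_gt1 : forall i, (1 < b i)%N) :
  let C := Cantor b in
  let KC : set C := @compact_elements _ C in
  KC = \bigcup_n range (@iota_C b n) /\
  exists phi : KC -> {i01 R},
    [/\ (forall n (x : Cfin b n) (k : KC),
           val k = iota_C x -> (phi k)%:num = phi_fin x),
        (forall k l : KC, (val k < val l)%O -> (phi k < phi l)%O),
        injective phi
      & exists Phi : C -> {i01 R},
          [/\ (forall x : C,
                 supremums [set phi k | k in [set k : KC | down_set x (val k)]]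
                   (Phi x)),
              (forall k : KC, Phi (val k) = phi k),
              [/\ continuous (Phi : lawson C -> lawson {i01 R}),
                  {homo Phi : x y / (x <= y)%O}
                & range Phi = setT]
            & forall x : C, KC x ->
                exists x' : C,
                  [/\ supremums (down_set x `\ x) x',
                      Phi x' = Phi x
                    & x <> (fun i => 0 : 'Z_(b i)) ->
                      @compact_elements _ C^d x'] ] ].
Proof.
set C := Cantor b; set KC : set C := compact_elements.
split; first exact: (compact_elementsE (R := R)).
have phi_lt (k l : KC) : (val k < val l)%O ->
    (value_i01 b_gt1 (val k) < value_i01 b_gt1 (val l) :> {i01 R})%O.
  move=> kl; rewrite -num_lt /= value_lt//; first exact: (set_valP k).
  exact: (set_valP l).
(* Taking [phi] as the restriction of [value_i01] makes the extension property hold by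
   definition. *)
exists (fun k => value_i01 b_gt1 (val k)); split=> //.
- move=> n x k kx; rewrite phi_finE//= kx -value_trunc//; congr value.
  have : range (@iota_C b n) (iota_C x) by exists x.
  by rewrite range_iota_C => /= ->.
- move=> k l kl; apply/val_inj; apply/eqP; apply: contraT.
  by rewrite neq_lt => /orP[]/phi_lt; rewrite kl ltxx.
exists (value_i01 b_gt1); split=> //.
- move=> x; split=> [_ [k kx <-]|u ub_u]; first exact: value_i01_homo.
  apply: value_i01_le => n.
  have cn : KC (trunc x n).
    exact: (compact_trunc (R := R) b_gt1 (trunc_trunc x (leqnn n))).
  by apply: ub_u; exists (SigSub (mem_set cn)) => //; exact: trunc_le.
- split; first exact: continuous_value_i01.
  + exact: value_i01_homo.
  + apply/seteqP; split=> // r _; exists (expansion r%:num) => //.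
    by apply/val_inj; rewrite /= value_expansion// i01_itv.
move=> x /(compact_elementsP (R := R) b_gt1)[n xn].
(* For the zero sequence the set below is empty and its supremum is the least element, so x' = x. *)
have [->|/eqP x0] := eqVneq x zeroC.
  exists zeroC; split=> //; split=> [y [y0 /eqP yN0]|y _]; last first.
    exact: (zeroC_le b_gt1).
  by move: yN0; rewrite eq_le; move: y0 => /= ->; rewrite (zeroC_le b_gt1).
have x'P z : (z < x)%O -> (z <= expansion (value (R := R) x))%O.
  exact: lt_expansion_value xn.
have x'x : (expansion (value (R := R) x) < x)%O.
  exact: expansion_value_lt xn x0.
exists (expansion (value (R := R) x)); split.
- exact: supremums_below_pred.
- by apply/val_inj; rewrite /= value_expansion// value01.
- by move=> _; exact: compact_elements_dual_pred x'x.
Qed.
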